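(* Let $\phi:Q\to Q'$ be a quandle homomorphism and let $A$ be an abelian $Q'$-quandle. If the set $\operatorname{Der}_\phi(Q,A)$ of all derivations from $Q$ to $A$ is non-empty, then it has the structure of an abelian quandle with respect to the binary operation given by $$(f*g)(q)=f(q)*g(q),$$ where $f,g\in\operatorname{Der}_\phi(Q,A)$ and $q\in Q$.
   Context: A quandle is a non-empty set $Q$ with a binary operation $*$ such that (Q1) $q*q=q$ for all $q$; (Q2) for all $q_1,q_2\in Q$ there is a unique $q\in Q$ with $q_2=q*q_1$; (Q3) $(q_1*q_2)*q_3=(q_1*q_3)*(q_2*q_3)$ for all $q_1,q_2,q_3$. A quandle homomorphism is a map $f$ with $f(q_1*q_2)=f(q_1)*f(q_2)$. A quandle $A$ is abelian (also called medial) if $(x*y)*(z*w)=(x*z)*(y*w)$ for all $x,y,z,w\in A$. The associated group $\operatorname{As}(Q)$ is the group generated by $\{e_q \mid q\in Q\}$ modulo the relations $e_{q_1*q_2}=e_{q_2}e_{q_1}e_{q_2}^{-1}$. A quandle homomorphism $\phi:Q\to Q'$ induces a group homomorphism $\phi:\operatorname{As}(Q)\to\operatorname{As}(Q')$, $\phi(e_q)=e_{\phi(q)}$. A quandle $A$ is a $Q'$-quandle if it is equipped with a (left) action $(g,a)\mapsto g\cdot a$ of $\operatorname{As}(Q')$ on $A$ by quandle automorphisms. Given a quandle homomorphism $\phi:Q\to Q'$ and a $Q'$-quandle $A$, a map $\partial:Q\to A$ is a derivation if $\partial(q_1*q_2)=\partial(q_1)*\big(\phi(e_{q_1})\cdot\partial(q_2)\big)$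 for all $q_1,q_2\in Q$; $\operatorname{Der}_\phi(Q,A)$ denotes the set of all derivations from $Q$ to $A$. *)

(* Defs.v *)
From HB Require Import structures.
From mathcomp Require Import all_boot.
From mathcomp Require Import boolp.

Set Implicit Arguments.
Unset Strict Implicit.
Unset Printing Implicit Defensive.

Local Open Scope group_scope.
Local Open Scope quotient_scope.

Record is_quandle (Q : Type) (op : Q -> Q -> Q) : Prop := IsQuandle {
  quandle_inhabited : inhabited Q;
  quandle_idem : idempotent_op op;
  quandle_div : forall q1 q2 : Q, exists! q : Q, q2 = op q q1;
  quandle_dist : left_distributive op op
}.

Definition abelian_op (Q : Type) (op : Q -> Q -> Q) : Prop :=
  interchange op op.

HB.mixin Record Magma_isQuandle Q of Magma Q := {
  quandleP : is_quandle (@mul Q)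
}.

(* The quandle operation is the magma product [x * y], so that quandle
   homomorphisms are exactly the maps in [{multiplicative Q -> Q'}]. *)
#[short(type="quandleType")]
HB.structure Definition Quandle := {Q of Magma_isQuandle Q & Magma Q}.

Definition abelian_quandle (A : quandleType) : Prop := abelian_op (@mul A).

Definition quandle_automorphism (A : quandleType) (f : A -> A) : Prop :=
  {morph f : x y / x * y} /\ bijective f.

(* Formal group expressions over the generators e_q, modulo the least
   congruence containing the group axioms and the defining relations. *)
Inductive as_term (Q : Type) : Type :=
| TGen of Q
| TOne
| TMul of as_term Q & as_term Q
| TInv of as_term Q.

Arguments TOne {Q}.

Inductive as_eqv (Q : quandleType) : as_term Q -> as_term Q -> Prop :=
| AsRefl t : as_eqv t t
| AsSym t u : as_eqv t u -> as_eqv u t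
| AsTrans t u v : as_eqv t u -> as_eqv u v -> as_eqv t v
| AsMul t t' u u' :
    as_eqv t t' -> as_eqv u u' -> as_eqv (TMul t u) (TMul t' u')
| AsInv t t' : as_eqv t t' -> as_eqv (TInv t) (TInv t')
| AsMulA t u v : as_eqv (TMul t (TMul u v)) (TMul (TMul t u) v)
| AsMul1 t : as_eqv (TMul TOne t) t
| AsMulr1 t : as_eqv (TMul t TOne) t
| AsMulV t : as_eqv (TMul (TInv t) t) TOne
| AsMulrV t : as_eqv (TMul t (TInv t)) TOne
| AsRel q1 q2 :
    as_eqv (TGen (q1 * q2))
           (TMul (TMul (TGen q2) (TGen q1)) (TInv (TGen q2))).

Section AssociatedGroup.
Variable Q : quandleType.

Let term := {classic (as_term Q)}.

Definition as_rel : rel term := fun t u => `[< as_eqv t u >].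

Lemma as_rel_refl : reflexive as_rel.
Proof. by move=> t; apply/asboolP; apply: AsRefl. Qed.

Lemma as_rel_sym : symmetric as_rel.
Proof. by move=> t u; apply/asboolP/asboolP; apply: AsSym. Qed.

Lemma as_rel_trans : transitive as_rel.
Proof.
by move=> u t v /asboolP tu /asboolP uv; apply/asboolP; apply: AsTrans tu uv.
Qed.

Canonical as_equiv : equiv_rel term :=
  EquivRel as_rel as_rel_refl as_rel_sym as_rel_trans.

Definition As : Type := {eq_quot as_equiv}.

HB.instance Definition _ := Choice.on As.
HB.instance Definition _ := Quotient.on As.

Definition as_class (t : as_term Q) : As := \pi_As (t : term).

Lemma as_classP (t u : as_term Q) : as_class t = as_class u <-> as_eqv t u.
Proof.
split=> [/eqmodP/asboolP //|tu].
by apply/eqmodP/asboolP.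
Qed.

Lemma as_classK (x : As) : as_class (repr x) = x.
Proof. exact: reprK. Qed.

Lemma as_repr (t : as_term Q) : as_eqv (repr (as_class t)) t.
Proof. by apply/as_classP; rewrite as_classK. Qed.

Definition as_mul (x y : As) : As := as_class (TMul (repr x) (repr y)).
Definition as_one : As := as_class TOne.
Definition as_inv (x : As) : As := as_class (TInv (repr x)).

Lemma as_mulE t u : as_mul (as_class t) (as_class u) = as_class (TMul t u).
Proof. by apply/as_classP; apply: AsMul; apply: as_repr. Qed.

Lemma as_invE t : as_inv (as_class t) = as_class (TInv t).
Proof. by apply/as_classP; apply: AsInv; apply: as_repr. Qed.

Lemma as_mulA : associative as_mul.
Proof.
move=> x y z; rewrite -[x]as_classK -[y]as_classK -[z]as_classK !as_mulE.
by apply/as_classP; apply: AsMulA.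
Qed.

Lemma as_mul1 : left_id as_one as_mul.
Proof.
by move=> x; rewrite -[x]as_classK as_mulE; apply/as_classP; apply: AsMul1.
Qed.

Lemma as_mulr1 : right_id as_one as_mul.
Proof.
by move=> x; rewrite -[x]as_classK as_mulE; apply/as_classP; apply: AsMulr1.
Qed.

Lemma as_mulV : left_inverse as_one as_inv as_mul.
Proof.
move=> x; rewrite -[x]as_classK as_invE as_mulE.
by apply/as_classP; apply: AsMulV.
Qed.

Lemma as_mulrV : right_inverse as_one as_inv as_mul.
Proof.
move=> x; rewrite -[x]as_classK as_invE as_mulE.
by apply/as_classP; apply: AsMulrV.
Qed.

HB.instance Definition _ :=
  isGroup.Build As as_mulA as_mul1 as_mulr1 as_mulV as_mulrV.

Definition as_gen (q : Q) : As := as_class (TGen q).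

Lemma as_genM (q1 q2 : Q) :
  as_gen (q1 * q2) = as_gen q2 * as_gen q1 * (as_gen q2)^-1.
Proof.
have -> : (as_gen q2)^-1 = as_class (TInv (TGen q2)) by exact: as_invE.
have -> : as_gen q2 * as_gen q1 = as_class (TMul (TGen q2) (TGen q1)).
  exact: as_mulE.
rewrite [RHS]as_mulE.
by apply/as_classP; apply: AsRel.
Qed.

End AssociatedGroup.

Section UniversalProperty.
Variables (Q : quandleType) (G : groupType) (f : Q -> G).
Hypothesis f_rel : forall q1 q2, f (q1 * q2) = f q2 * f q1 * (f q2)^-1.

Fixpoint as_eval (t : as_term Q) : G :=
  match t with
  | TGen q => f q
  | TOne => 1
  | TMul t u => as_eval t * as_eval u
  | TInv t => (as_eval t)^-1
  end.

Lemma as_eval_eqv t u : as_eqv t u -> as_eval t = as_eval u.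
Proof.
elim=> //= {t u}.
- by move=> t u v _ -> _ ->.
- by move=> t t' u u' _ -> _ ->.
- by move=> t t' _ ->.
- by move=> t u v; rewrite mulgA.
- by move=> t; rewrite mul1g.
- by move=> t; rewrite mulg1.
- by move=> t; rewrite mulVg.
- by move=> t; rewrite mulgV.
Qed.

Definition as_lift (x : As Q) : G := as_eval (repr x).

Lemma as_lift_class t : as_lift (as_class t) = as_eval t.
Proof. by apply: as_eval_eqv; apply: as_repr. Qed.

Lemma as_lift_gen q : as_lift (as_gen q) = f q.
Proof. exact: as_lift_class. Qed.

Lemma as_liftM : {morph as_lift : x y / x * y}.
Proof.
move=> x y; rewrite -[x]as_classK -[y]as_classK.
by rewrite [_ * _]as_mulE !as_lift_class.
Qed.

Lemma as_lift_unique (h : As Q -> G) :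
  {morph h : x y / x * y} -> (forall q, h (as_gen q) = f q) -> h =1 as_lift.
Proof.
move=> hM hgen x; rewrite -[x]as_classK as_lift_class.
have h1 : h 1 = 1 by apply: (@mulgI _ (h 1)); rewrite -hM !mulg1.
elim: (repr x : as_term Q) => //= [t IHt u IHu|t IHt].
- by rewrite -as_mulE hM IHt IHu.
- apply: (@mulgI _ (h (as_class t))).
  by rewrite -as_invE -hM IHt !mulgV.
Qed.

End UniversalProperty.

Section Functoriality.
Variables (Q Q' : quandleType) (phi : {multiplicative Q -> Q'}).

Definition as_map : As Q -> As Q' := as_lift (fun q => as_gen (phi q)).

Lemma as_map_rel q1 q2 : as_gen (phi (q1 * q2)) =
  as_gen (phi q2) * as_gen (phi q1) * (as_gen (phi q2))^-1.
Proof. by rewrite gmulfM as_genM. Qed.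

Lemma as_map_gen q : as_map (as_gen q) = as_gen (phi q).
Proof. exact: (as_lift_gen as_map_rel). Qed.

Lemma as_mapM : {morph as_map : x y / x * y}.
Proof. exact: (as_liftM as_map_rel). Qed.

HB.instance Definition _ := isMultiplicative.Build (As Q) (As Q') as_map as_mapM.

End Functoriality.

HB.mixin Record hasAsAction (Q' : quandleType) A of Quandle A := {
  qact : As Q' -> A -> A;
  qact1 : forall a : A, qact 1 a = a;
  qactM : forall (g h : As Q') (a : A), qact (g * h) a = qact g (qact h a);
  qact_aut : forall g : As Q', quandle_automorphism (qact g)
}.

#[short(type="actedQuandleType")]
HB.structure Definition ActedQuandle (Q' : quandleType) :=
  {A of hasAsAction Q' A & Quandle A}.

Definition is_derivation (Q Q' : quandleType) (phi : {multiplicative Q -> Q'})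
    (A : actedQuandleType Q') (d : Q -> A) : Prop :=
  forall q1 q2 : Q, d (q1 * q2) = d q1 * qact (as_map phi (as_gen q1)) (d q2).

Record Der (Q Q' : quandleType) (phi : {multiplicative Q -> Q'})
    (A : actedQuandleType Q') : Type := MkDer {
  der_fun :> Q -> A;
  der_derivation : is_derivation phi der_fun
}.

(* Main.v *)
(** For abelian [A] the product of two derivations is a derivation by the
    interchange law.  For division, given derivations [f] and [g], the pointwise
    quotient [h], determined by [g q = h q * f q], is again a derivation: by
    interchange [h q1 * e.h q2] solves [g (q1 * q2) = _ * f (q1 * q2)], and
    this solution is unique in [A]. *)

Require Import Defs.
From HB Require Import structures.
From mathcomp Require Import all_boot.
From mathcomp Require Import boolp.

Local Open Scope group_scope.

(** The uniqueness half of the division axiom, in the form of right cancellation. *)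
Lemma quandle_mulIq (A : quandleType) (a x y : A) : x * a = y * a -> x = y.
Proof.
move=> eq_xy; have [z [_ z_uniq]] := quandle_div quandleP a (x * a).
by rewrite -(z_uniq x) // -(z_uniq y).
Qed.

Section Derivations.
Variables (Q Q' : quandleType) (phi : {multiplicative Q -> Q'}).
Variable A : actedQuandleType Q'.

(** By proof irrelevance only the underlying map matters, so each quandle law on [Der phi A] can be
    checked pointwise in [A]. *)
Lemma der_ext (f g : Der phi A) : f =1 g -> f = g.
Proof.
case: f g => [f df] [g dg] /= /funext fg; case: _ / fg in dg *.
by rewrite (Prop_irrelevance df dg).
Qed.

Hypothesis hA : abelian_quandle A.

Lemma is_derivation_mul (f g : Der phi A) :
  is_derivation phi (fun q => f q * g q).
Proof.
move=> q1 q2; rewrite (der_derivation f) (der_derivation g).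
by rewrite (qact_aut _).1 [LHS]hA.
Qed.

Definition der_mul (f g : Der phi A) : Der phi A := MkDer (is_derivation_mul f g).

Lemma is_derivation_div (f g : Der phi A) (h : Q -> A) :
  (forall q, g q = h q * f q) -> is_derivation phi h.
Proof.
move=> gE q1 q2; apply: (@quandle_mulIq _ (f (q1 * q2))).
rewrite -gE (der_derivation g) (der_derivation f) [RHS]hA.
(* Pulling the action out of the product leaves factors [h q * f q], which are values of [g]. *)
by rewrite -(qact_aut _).1 -!gE.
Qed.

Lemma der_mul_div (f g : Der phi A) : exists! h, g = der_mul h f.
Proof.
(* Division in [A] is solved point by point; [choice] collects the solutions into one map. *)
have /choice[h gE] : forall q, exists a, g q = a * f q.
  by move=> q; have [a [ga _]] := quandle_div quandleP (f q) (g q); exists a.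
exists (MkDer (is_derivation_div f g h gE)); split; first exact: der_ext.
(* Any other quotient [k] agrees with [h] at each [q] by cancelling [f q]. *)
move=> k gk; apply: der_ext => q; apply: (@quandle_mulIq _ (f q)).
by rewrite /= -gE gk.
Qed.

Lemma is_quandle_der_mul : inhabited (Der phi A) -> is_quandle der_mul.
Proof.
move=> hDer; split=> //.
- by move=> f; apply: der_ext => q; apply: (quandle_idem quandleP).
- exact: der_mul_div.
- by move=> f g h; apply: der_ext => q; apply: (quandle_dist quandleP).
Qed.

Lemma abelian_der_mul : abelian_op der_mul.
Proof. by move=> f g h k; apply: der_ext => q; apply: hA. Qed.

End Derivations.

Theorem theorem4p1 (Q Q' : quandleType) (phi : {multiplicative Q -> Q'})
    (A : actedQuandleType Q') (hA : abelian_quandle A)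
    (hDer : inhabited (Der phi A)) :
  exists op : Der phi A -> Der phi A -> Der phi A,
    [/\ forall (f g : Der phi A) (q : Q), op f g q = (f q * g q)%g,
        is_quandle op
      & abelian_op op].
Proof.
exists (der_mul Q Q' phi A hA); split=> //.
- exact: is_quandle_der_mul.
- exact: abelian_der_mul.
Qed.
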